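(* Let $q$ be a prime power and $n$ a positive integer with $\gcd(n,q)=1$, and let $\mathbb{L}|\mathbb{F}_q$ be a field extension with $U_n\subseteq\mathbb{L}$. Let $C$ be a nonzero cyclic code in $\mathbb{F}_q(n)$. Then $d(C)=\Delta(C)$ if and only if there exist $k\in\{0,\dots,n-1\}$, a divisor $g\mid x^n-1$ in $\mathbb{L}[x]$ and $\alpha\in\mathcal{R}(C)$ such that, setting $f=\overline{x^kg}$, the following conditions hold: (1) $d^\ast(g)=d^\ast(C)$; (2) $\mathrm{supp}(f)\subseteq\mathbb{Z}_n\setminus D_\alpha(C)$; (3) $(f(\alpha^j))^q=f(\alpha^j)$ for every $j\in\{0,\dots,n-1\}$.
   Context: $U_n$ is the set of primitive $n$-th roots of unity. For a field $F$, $F(n)=F[x]/(x^n-1)$; its elements are identified with polynomials of degree $<n$, and $\overline{f}$ is the image of $f\in F[x]$ in $F(n)$, i.e. its remainder modulo $x^n-1$. For $f\in F(n)$, $\mathrm{supp}(f)\subseteq\{0,\dots,n-1\}=\mathbb{Z}_n$ is the set of exponents $i$ for which $x^i$ has nonzero coefficient in $f$. A cyclic code is an ideal $C$ of $\mathbb{F}_q(n)$; $\omega(c)=|\mathrm{supp}(c)|$ and $d(C)=\min\{\omega(c): 0\neq c\in C\}$. For $\alpha\in U_n$, the defining set is $D_\alpha(C)=\{i\in\mathbb{Z}_n : c(\alpha^i)=0 \text{ for all } c\in C\}$. The BCH bounds of $C$ are the integers $\delta$ such that, for some $\alpha\in U_n$, $D_\alpha(C)$ contains $\delta-1$ consecutive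 integers modulo $n$; $\Delta(C)$ is the maximum of the BCH bounds of $C$. For $c\in\mathbb{F}_q(n)$ and $\alpha\in U_n$, the Fourier transform is $\varphi_{\alpha,c}(x)=\sum_{j=0}^{n-1}c(\alpha^j)x^j\in\mathbb{L}(n)$. The apparent distance of $g\in\mathbb{L}(n)$ is $d^\ast(0)=0$ and, for $g\ne0$, $d^\ast(g)=\max\{n-\deg(\overline{x^hg}): 0\le h\le n-1\}$ (for a polynomial $g\in\mathbb{L}[x]$, $d^\ast(g)$ means $d^\ast(\overline{g})$). For a nonzero cyclic code $C$: $d^\ast_\alpha(C)=\min_{0\ne c\in C}d^\ast(\varphi_{\alpha,c})$, $d^\ast(C)=\max_{\alpha\in U_n}d^\ast_\alpha(C)$, and $\mathcal{R}(C)=\{\beta\in U_n: d^\ast_\beta(C)=d^\ast(C)\}$. It is a known fact (Camion) that $d^\ast(C)=\Delta(C)$. *)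

(* Defs.v *)
(* MathComp, with the classical sets and finitely supported big operators of
   mathcomp-classical. *)
From HB Require Import structures.
From mathcomp Require Import all_boot all_order all_algebra.
From mathcomp Require Import qpoly.
From mathcomp Require Import mathcomp_extra boolp classical_sets fsbigop.

Set Implicit Arguments.
Unset Strict Implicit.
Unset Printing Implicit Defensive.

Import GRing.Theory.
Local Open Scope ring_scope.

(* K(n) = K[x]/(x^n - 1).  For n > 0 an element of this ring is literally its
   representative of degree < n (it coerces to {poly K}). *)
Notation cycring K n := {poly %/ ('X^n - 1 : {poly K})}.

Definition qbar (K : nzRingType) (n : nat) (f : {poly K}) : cycring K n :=
  in_qpoly ('X^n - 1) f.

Definition supp (K : nzRingType) (n : nat) (f : cycring K n) : {set 'I_n} :=
  [set i : 'I_n | (f : {poly K})`_i != 0].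

Definition weight (K : nzRingType) (n : nat) (f : cycring K n) : nat :=
  #|supp f|.

Definition Uroots (L : nzRingType) (n : nat) : set L :=
  [set a : L | n.-primitive_root a]%classic.
Arguments Uroots : clear implicits.

(* The library's [idealr_closed] demands that the ideal be proper; the full
   ring is a cyclic code too. *)
Definition cyclic_code (F : finFieldType) (n : nat) (C : {set cycring F n}) :
    Prop :=
  [/\ 0 \in C, {in C &, forall u v, u + v \in C}
    & forall a, {in C, forall u, a * u \in C}].

(* The default value n of the minimum is harmless: weights are at most n. *)
Definition min_dist (F : finFieldType) (n : nat) (C : {set cycring F n}) : nat :=
  \big[minn/n]_(c in C | c != 0) weight c.

(* g != 0 implies x^h g != 0 in K(n), x being invertible there, so its degree is
   its size minus one. *)
Definition app_dist (K : fieldType) (n : nat) (g : cycring K n) : nat :=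
  if g == 0 then 0%N
  else \max_(h < n)
    (n - (size (qbar n ('X^h * (g : {poly K}))%R : {poly K})).-1)%N.

Section Codes.
Variables (F : finFieldType) (L : fieldType) (iota : {rmorphism F -> L}).
Variable n : nat.
Implicit Types (c : cycring F n) (C : {set cycring F n}) (a : L).

Definition code_eval c a : L := (map_poly iota c).[a].

Definition defining_set C a : {set 'I_n} :=
  [set i : 'I_n | [forall c in C, code_eval c (a ^+ i) == 0]].

Definition BCH_bound C (delta : nat) : Prop :=
  (0 < delta)%N /\
  exists2 a : L, n.-primitive_root a
    & exists s : nat, forall i : nat, (i < delta.-1)%N ->
        exists2 j : 'I_n, j = s + i %[mod n] & j \in defining_set C a.

(* For a nonzero code a defining set is not the whole of Z_n, so there are
   finitely many BCH bounds and this is their maximum. *)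
Definition max_BCH_bound C : nat :=
  \big[maxn/0%N]_(delta \in [set d | BCH_bound C d]%classic) delta.

Definition fourier a c : cycring L n :=
  qbar n (\sum_(j < n) (code_eval c (a ^+ j))%:P * 'X^j).

(* The default value n of the minimum is harmless: apparent distances are at
   most n. *)
Definition app_dist_at C a : nat :=
  \big[minn/n]_(c in C | c != 0) app_dist (fourier a c).

Definition code_app_dist C : nat :=
  \big[maxn/0%N]_(a \in Uroots L n) app_dist_at C a.

Definition Rset C : set L :=
  [set b | Uroots L n b /\ app_dist_at C b = code_app_dist C]%classic.

End Codes.

(* Main.v *)
(* Evaluating the Fourier transform phi of c at the powers of alpha^-1 returns
   n times the coefficients of c, so the weight of c is the number of n-th
   roots of unity at which phi does not vanish.  Any shift x^h phi has the same
   zeros among the roots of unity, and a polynomial has at most deg zeros, so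
   this number is at least d*(phi); equality holds exactly when some shift of
   phi of minimal degree has all its roots simple and among the roots of unity,
   i.e. divides x^n - 1.  This is the divisor g of the theorem, and phi is one
   of its shifts.
   Camion's equality d*(C) = Delta(C) comes from a generator of C, whose
   transform vanishes exactly on the defining set. *)
Require Import Defs.
From HB Require Import structures.
From mathcomp Require Import all_boot all_order all_algebra.
From mathcomp Require Import qpoly finfield.
From mathcomp Require Import mathcomp_extra boolp classical_sets fsbigop.
From mathcomp Require Import cardinality zify.
Set Implicit Arguments.
Unset Strict Implicit.
Unset Printing Implicit Defensive.

Import GRing.Theory.
Local Open Scope ring_scope.

(** * Minima and maxima of natural numbers over finite sets *)

Section FiniteExtrema.

Lemma bigminn_le (I : finType) (P : pred I) (F : I -> nat) x j :
  P j -> (\big[minn/x]_(i | P i) F i <= F j)%N.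
Proof.
by move=> Pj; rewrite -leEnat -minEnat Order.TotalTheory.bigmin_le_cond.
Qed.

Lemma bigminn_geP (I : finType) (P : pred I) (F : I -> nat) x m :
  reflect ((m <= x)%N /\ forall i, P i -> (m <= F i)%N)
          (m <= \big[minn/x]_(i | P i) F i)%N.
Proof. by rewrite -leEnat -minEnat; apply: Order.TotalTheory.bigmin_geP. Qed.

Lemma bigminn_attained (I : finType) (P : pred I) (F : I -> nat) x j :
    P j -> (forall i, P i -> (F i <= x)%N) ->
  exists2 i, P i & \big[minn/x]_(i | P i) F i = F i.
Proof.
move=> Pj leFx; rewrite -minEnat (Order.TotalTheory.bigmin_eq_arg _ j) //.
by case: Order.TotalTheory.arg_minP => // i Pi _; exists i.
Qed.

(** Finiteness of [A] matters: a big operator over a set with infinite support falls back to its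
    neutral element, here 0. *)
Lemma leq_fsbigmax (T : choiceType) (A : set T) (F : T -> nat) a :
  finite_set A -> A a -> (F a <= \big[maxn/0%N]_(i \in A) F i)%N.
Proof. by move=> finA Aa; rewrite (fsbigD1 a) //= leq_maxl. Qed.

Lemma fsbigmax_attained (T : choiceType) (A : set T) (F : T -> nat) a :
  finite_set A -> A a -> exists2 b, A b & \big[maxn/0%N]_(i \in A) F i = F b.
Proof.
move=> finA Aa.
have [b [Ab maxFb]] : exists b, A b /\ forall c, A c -> (F c <= F b)%N.
  pose P m := `[< exists2 b, A b & F b = m >].
  have exP : exists m, P m by exists (F a); apply/asboolP; exists a.
  have ubP m : P m -> (m <= \big[maxn/0%N]_(i \in A) F i)%N.
    by move=> /asboolP[b Ab <-]; apply: leq_fsbigmax.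
  have [m /asboolP[b Ab <-] maxm] := ex_maxnP exP ubP.
  by exists b; split=> // c Ac; apply: maxm; apply/asboolP; exists c.
exists b => //; apply/eqP; rewrite eqn_leq leq_fsbigmax // andbT.
rewrite fsbig_finite //; apply/bigmax_leqP_seq=> c + _.
by rewrite in_fset_set // inE; apply: maxFb.
Qed.

End FiniteExtrema.

(** * Cyclic shifts and apparent distance in K(n) *)

Section Cycring.
Variables (K : fieldType) (n : nat).
Hypothesis n_gt0 : (0 < n)%N.
Implicit Types (v : cycring K n) (p : {poly K}) (h i : nat).

Lemma cycring_inj (u v : cycring K n) : u = v :> {poly K} -> u = v.
Proof. exact: val_inj. Qed.

Lemma cycring_eq0 v : ((v : {poly K}) == 0) = (v == 0).
Proof. by apply/eqP/eqP=> [v0 | ->] //; apply: cycring_inj. Qed.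

(** The quotient type reduces modulo [mk_monic h], which returns [h] only when it is monic and
    nonconstant; n > 0 ensures this here. *)
Lemma mk_monic_Xnsub1 : mk_monic ('X^n - 1 : {poly K}) = 'X^n - 1.
Proof. by rewrite /mk_monic size_XnsubC // ltnS n_gt0 monicXnsubC. Qed.

Lemma qbarE p : qbar n p = p %% ('X^n - 1) :> {poly K}.
Proof.
by rewrite /= mk_monic_Xnsub1 Pdiv.IdomainMonic.modpE // monicXnsubC.
Qed.

Lemma size_cycring v : (size (v : {poly K}) <= n)%N.
Proof.
rewrite -ltnS (leq_trans (size_mk_monic v)) //.
by rewrite mk_monic_Xnsub1 size_XnsubC.
Qed.

Lemma qbar_small p : (size p <= n)%N -> qbar n p = p :> {poly K}.
Proof. by move=> le_pn; rewrite qbarE modp_small // size_XnsubC // ltnS. Qed.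

Lemma qbarK v : qbar n v = v.
Proof. by apply: cycring_inj; rewrite qbar_small ?size_cycring. Qed.

Lemma horner_qbar p z : z ^+ n = 1 -> (qbar n p : {poly K}).[z] = p.[z].
Proof.
move=> zn1; rewrite [in RHS](divp_eq p ('X^n - 1)) qbarE !hornerE zn1.
by rewrite subrr mulr0 add0r.
Qed.

Lemma qbarD p1 p2 : qbar n (p1 + p2) = qbar n p1 + qbar n p2.
Proof. exact: in_qpolyD. Qed.

Lemma qbarM p1 p2 : qbar n (p1 * p2) = qbar n p1 * qbar n p2.
Proof. exact: in_qpolyM. Qed.

Lemma qbarXn i : qbar n 'X^i = 'X^(i %% n) :> {poly K}.
Proof.
have Xn1 : qbar n ('X^n : {poly K}) = 1.
  rewrite -[X in qbar n X](subrK 1) /qbar rmorphD rmorph1 /=.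
  suff ->: in_qpoly ('X^n - 1 : {poly K}) ('X^n - 1) = 0 by rewrite add0r.
  by apply: cycring_inj; rewrite [LHS]qbarE modpp.
rewrite {1}(divn_eq i n) exprD mulnC exprM qbarM.
have ->: qbar n ('X^n ^+ (i %/ n) : {poly K}) = 1.
  by rewrite /qbar rmorphXn /= -/(qbar _ _) Xn1 expr1n.
rewrite mul1r.
apply: qbar_small.
by rewrite size_polyXn ltn_mod.
Qed.

(** Multiplication by x^h rotates the coefficients, as x^n = 1. By linearity it is enough to follow
    each monomial. *)
Lemma coef_shift h v i : (i < n)%N ->
  (qbar n ('X^h * (v : {poly K})) : {poly K})`_((i + h) %% n) = v`_i.
Proof.
move=> lt_in; have {1}-> : (v : {poly K}) = \sum_(j < n) v`_j *: 'X^j.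
  by rewrite -poly_def; apply/polyP=> j; rewrite coef_poly; case: ltnP => // ?;
     rewrite nth_default // (leq_trans (size_cycring v)).
rewrite mulr_sumr /qbar rmorph_sum poly_of_qpoly_sum coef_sum.
under eq_bigr => j _ do rewrite -scalerAr -exprD.
have coefj (j : 'I_n) :
    (in_qpoly ('X^n - 1 : {poly K}) (v`_j *: 'X^(h + j)) : {poly K})
      `_((i + h) %% n) = v`_j * (j == i :> nat)%:R.
  rewrite in_qpolyZ coefZ [\val _]qbarXn coefXn addnC eqn_modDl.
  by rewrite !modn_small // eq_sym.
rewrite (eq_bigr _ (fun j _ => coefj j)) (bigD1 (Ordinal lt_in)) //= eqxx mulr1.
rewrite big1 ?addr0 // => j /negPf; rewrite -val_eqE /= => ->.
by rewrite mulr0.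
Qed.

Lemma qbar_shift_eq0 h v : (qbar n ('X^h * (v : {poly K})) == 0) = (v == 0).
Proof.
apply/eqP/eqP=> [sv0 | ->]; last by rewrite mulr0 /qbar rmorph0.
apply: cycring_inj; apply/polyP=> i; rewrite coef0.
have [lt_in | le_ni] := ltnP i n; first by rewrite -(coef_shift h) // sv0 coef0.
by rewrite nth_default // (leq_trans (size_cycring v)).
Qed.

(** A subtraction-free form of n - deg(x^h v) <= d*(v), the degree being the size minus one. *)
Lemma app_dist_bound v h : v != 0 -> (h < n)%N ->
  (n < size (qbar n ('X^h * (v : {poly K}))%R : {poly K}) + app_dist v)%N.
Proof.
move=> v_neq0 lt_hn; rewrite /app_dist (negPf v_neq0).
set w := (qbar _ _ : {poly K}); rewrite -leq_subLR.
apply: leq_trans (leq_bigmax_cond (Ordinal lt_hn) isT); rewrite /= -/w.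
have : (size w <= n)%N by apply: size_cycring.
have : (0 < size w)%N by rewrite size_poly_gt0 /w cycring_eq0 qbar_shift_eq0.
by move: (size w) => s *; lia.
Qed.

Lemma app_dist_attained v : v != 0 -> exists2 h, (h < n)%N &
  (size (qbar n ('X^h * (v : {poly K}))%R : {poly K}) + app_dist v)%N = n.+1.
Proof.
move=> v_neq0; rewrite /app_dist (negPf v_neq0).
rewrite (bigmax_eq_arg (Ordinal n_gt0)) //; set h := [arg max_(i > _) _].
exists h => //; set w := (qbar _ _ : {poly K}).
have : (size w <= n)%N by apply: size_cycring.
have : (0 < size w)%N by rewrite size_poly_gt0 /w cycring_eq0 qbar_shift_eq0.
by move: (size w) => s *; lia.
Qed.

Lemma app_dist_gt0 v : v != 0 -> (0 < app_dist v)%N.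
Proof.
case/app_dist_attained=> h _; set w := qbar _ _.
by have := size_cycring w; move: (size w) => s *; lia.
Qed.

End Cycring.

(** * Counting the n-th roots of unity at which a polynomial does not vanish *)

Section NonRoots.
Variables (K : fieldType) (n : nat) (a : K).
Hypothesis prim_a : n.-primitive_root a.
Implicit Types (v : cycring K n) (p : {poly K}).

Let n_gt0 : (0 < n)%N := prim_order_gt0 prim_a.

Definition nonroots p : nat := #|[set i : 'I_n | p.[a ^+ i] != 0]|.

Definition unity_roots p :=
  [seq a ^+ i | i : 'I_n in [pred i : 'I_n | root p (a ^+ i)]].

Lemma prim_expr_inj : injective (fun i : 'I_n => a ^+ i).
Proof.
move=> i j /eqP; rewrite (eq_prim_root_expr prim_a) !modn_small // => /eqP.
exact: val_inj.
Qed.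

Lemma prim_exprXn1 i : (a ^+ i) ^+ n = 1.
Proof. by rewrite exprAC (prim_expr_order prim_a) expr1n. Qed.

Lemma unity_roots_uniq p : uniq (unity_roots p).
Proof. by rewrite map_inj_uniq ?enum_uniq //; apply: prim_expr_inj. Qed.

Lemma all_unity_roots p : all (root p) (unity_roots p).
Proof. by apply/allP=> _ /mapP[i + ->]; rewrite mem_enum. Qed.

Lemma size_unity_roots p : (size (unity_roots p) + nonroots p = n)%N.
Proof.
rewrite size_map -cardE -[RHS]card_ord.
rewrite -(cardC [pred i : 'I_n | root p (a ^+ i)]).
by congr (_ + _)%N; apply: eq_card => i; rewrite !inE rootE.
Qed.

Lemma nonroots_le p : (nonroots p <= n)%N.
Proof. by rewrite -[leqRHS](size_unity_roots p) leq_addl. Qed.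

Lemma size_nonroots p : p != 0 -> (n < size p + nonroots p)%N.
Proof.
move=> p_neq0; rewrite -[X in (X < _)%N](size_unity_roots p) ltn_add2r.
exact: max_poly_roots p_neq0 (all_unity_roots p) (unity_roots_uniq p).
Qed.

Lemma nonroots0 p : (forall i : 'I_n, p.[a ^+ i] = 0) -> nonroots p = 0%N.
Proof.
move=> p0; apply/eqP; rewrite cards_eq0; apply/eqP/setP=> i.
by rewrite !inE p0 eqxx.
Qed.

Lemma poly0_on_unity p :
  (size p <= n)%N -> (forall i : 'I_n, p.[a ^+ i] = 0) -> p = 0.
Proof.
move=> le_pn /nonroots0 p0; apply: contraTeq le_pn => /size_nonroots.
by rewrite p0 addn0 ltnNge.
Qed.

Lemma cycring_eq_on_unity (u v : cycring K n) :
  (forall i : 'I_n, (u : {poly K}).[a ^+ i] = (v : {poly K}).[a ^+ i]) -> u = v.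
Proof.
move=> euv; apply: cycring_inj; apply/eqP; rewrite -subr_eq0; apply/eqP.
apply: poly0_on_unity => [|i]; last by rewrite !hornerE euv subrr.
by rewrite (leq_trans (size_polyD _ _)) // size_polyN geq_max !size_cycring.
Qed.

Lemma dvdp_Xnsub1_on_unity p :
  (forall i : 'I_n, p.[a ^+ i] = 0) -> 'X^n - 1 %| p.
Proof.
move=> p0; rewrite /dvdp -qbarE //.
suff ->: qbar n p = 0 by [].
apply: cycring_eq_on_unity => i.
by rewrite horner_qbar ?prim_exprXn1 // p0 horner0.
Qed.

Lemma nonrootsM_le p r : (forall i : 'I_n, (p * r).[a ^+ i] = 0) ->
  (nonroots p + nonroots r <= n)%N.
Proof.
move=> pr0; rewrite -[leqRHS]card_ord -cardsUI [X in (_ + X)%N](_ : _ = 0%N).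
  by rewrite addn0 max_card.
apply/eqP; rewrite cards_eq0; apply/eqP/setP=> i; rewrite !inE.
by have /eqP := pr0 i; rewrite hornerM mulf_eq0 -negb_or => ->.
Qed.

(** With x^n - 1 = r p, the degree bound of [size_nonroots] holds for r and for p. The sizes add up
    to n + 2 and the nonroots of r and p are disjoint, hence at most n together, so both bounds are
    equalities. *)
Lemma size_nonroots_dvd p : p %| 'X^n - 1 -> (size p + nonroots p)%N = n.+1.
Proof.
move=> /dvdpP/= [r Xn1E].
have Xn1_neq0 : 'X^n - 1 != 0 :> {poly K} by rewrite -size_poly_gt0 size_XnsubC.
have /norP[r_neq0 p_neq0] : ~~ ((r == 0) || (p == 0)).
  by rewrite -mulf_eq0 -Xn1E.
have := size_mul r_neq0 p_neq0; rewrite -Xn1E size_XnsubC // => sz.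
have := size_nonroots p_neq0; have := size_nonroots r_neq0.
have : (nonroots r + nonroots p <= n)%N.
  by apply: nonrootsM_le => i; rewrite -Xn1E !hornerE prim_exprXn1 subrr.
have : (0 < size r)%N by rewrite size_poly_gt0.
move: sz; move: (size r) (size p) (nonroots r) (nonroots p) => *; lia.
Qed.

(** Equality in the degree bound says that p has as many distinct roots among the powers of [a] as
    its degree, so p is a scalar times a product of distinct factors of x^n - 1. *)
Lemma dvd_size_nonroots p :
  p != 0 -> (size p + nonroots p)%N = n.+1 -> p %| 'X^n - 1.
Proof.
move=> p_neq0 szp; have Urs : uniq_roots (unity_roots p).
  by rewrite uniq_rootsE unity_roots_uniq.
have szE : size p = (size (unity_roots p)).+1.
  have := size_unity_roots p; move: szp.
  by move: (size p) (nonroots p) (size (unity_roots p)) => *; lia.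
rewrite (all_roots_prod_XsubC szE (all_unity_roots p) Urs).
rewrite dvdpZl ?lead_coef_eq0 //; apply: uniq_roots_dvdp Urs.
apply/allP=> _ /mapP[i _ ->].
by rewrite rootE !hornerE prim_exprXn1 subrr.
Qed.

Lemma nonroots_shift h p : nonroots ('X^h * p) = nonroots p.
Proof.
apply: eq_card => i; rewrite !inE hornerM hornerXn mulf_eq0 negb_or.
by rewrite -exprM expf_eq0 (prim_root_eq0 prim_a) (gtn_eqF n_gt0) andbF.
Qed.

Lemma nonroots_qbar p : nonroots (qbar n p) = nonroots p.
Proof. by apply: eq_card => i; rewrite !inE horner_qbar // prim_exprXn1. Qed.

(** The degree bound is applied to the shift of least degree, which has the same zeros as v among
    the roots of unity. *)
Lemma app_dist_le_nonroots v : (app_dist v <= nonroots v)%N.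
Proof.
have [->|v_neq0] := eqVneq v 0; first by rewrite /app_dist eqxx.
have [h _ szw] := app_dist_attained n_gt0 v_neq0.
have := @size_nonroots (qbar n ('X^h * (v : {poly K}))).
rewrite nonroots_qbar nonroots_shift cycring_eq0 qbar_shift_eq0 //.
by move/(_ v_neq0); rewrite -szw leq_add2l.
Qed.

Lemma app_dist_le v : (app_dist v <= n)%N.
Proof. exact: leq_trans (app_dist_le_nonroots v) (nonroots_le _). Qed.

End NonRoots.

(** * Apparent distance as the length of a cyclic run of zero coefficients *)

Section CyclicRuns.
Variables (K : fieldType) (n : nat).
Hypothesis n_gt0 : (0 < n)%N.
Implicit Types (v : cycring K n).

Lemma app_dist_run v s d : v != 0 ->
    (forall i, (i < d)%N -> (v : {poly K})`_((s + i) %% n) = 0) ->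
  (d < app_dist v)%N.
Proof.
move=> v_neq0 run0; have lt_dn : (d < n)%N.
  rewrite ltnNge; apply: contraNN v_neq0 => le_nd.
  apply/eqP/cycring_inj/polyP=> i; rewrite coef0.
  have [lt_in|le_ni] := ltnP i n; last first.
    by rewrite nth_default // (leq_trans (size_cycring n_gt0 v)).
  (* The offset at which a run starting at s reaches position i. *)
  pose k := ((i + (n - s %% n)) %% n)%N.
  have lt_kd : (k < d)%N by rewrite (leq_trans _ le_nd) // ltn_mod.
  apply: etrans (run0 k lt_kd); congr nth.
  rewrite -[LHS](modn_small lt_in) modnDmr -modnDml.
  have ->: (s %% n + (i + (n - s %% n)) = i + n)%N.
    by have := ltn_pmod s n_gt0; lia.
  by rewrite modnDr.
(* This shift carries the run s, ..., s + d - 1 to the top positions n - d, ..., n - 1, which lowers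
   the size to at most n - d. *)
pose h := ((n - d + (n - s %% n)) %% n)%N.
have lt_hn : (h < n)%N by rewrite ltn_mod.
have := app_dist_bound n_gt0 v_neq0 lt_hn; set w := qbar _ _ => ltn_w.
have: (size (w : {poly K}) <= n - d)%N; last first.
  by move: ltn_w; move: (size w) => m; lia.
apply/leq_sizeP=> m le_m; have [lt_mn|le_nm] := ltnP m n; last first.
  by rewrite nth_default // (leq_trans (size_cycring n_gt0 w)).
pose i := (m - (n - d))%N; have lt_id : (i < d)%N by rewrite /i; lia.
apply: etrans (run0 i lt_id).
rewrite -[RHS](coef_shift n_gt0 h) ?ltn_mod // -/w; congr nth.
rewrite -[LHS](modn_small lt_mn) /h modnDm -addnA -modnDml.
have ->: (s %% n + (i + (n - d + (n - s %% n))) = m + n)%N.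
  by have := ltn_pmod s n_gt0; rewrite /i; lia.
by rewrite modnDr.
Qed.

Lemma app_dist_run_exists v : v != 0 -> exists s,
  forall i, (i < (app_dist v).-1)%N -> (v : {poly K})`_((s + i) %% n) = 0.
Proof.
move=> v_neq0; have [h lt_hn] := app_dist_attained n_gt0 v_neq0.
(* In the shift w of least degree the coefficients from position [size w] up to n - 1 vanish.
   Rotating back by h makes the run start at [size w] - h modulo n; its length n - [size w] is d*(v)
   - 1. *)
set w := qbar _ _ => szw; exists (size (w : {poly K}) + (n - h))%N => i lt_i.
rewrite -(coef_shift n_gt0 h) ?ltn_mod // -/w nth_default // modnDml.
have ->: (size (w : {poly K}) + (n - h) + i + h
          = size (w : {poly K}) + i + n)%N.
  by move: (size w) => m; lia.
rewrite modnDr modn_small ?leq_addr //.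
by move: szw lt_i; move: (size w) (app_dist v) => m d; lia.
Qed.

End CyclicRuns.

(** * The Fourier transform and its inverse *)

Lemma sum_unity_root (K : fieldType) (n : nat) (z : K) :
  z ^+ n = 1 -> \sum_(j < n) z ^+ j = n%:R *+ (z == 1).
Proof.
move=> zn1; have [->|z_neq1] := eqVneq z 1.
  under eq_bigr do rewrite expr1n.
  by rewrite sumr_const card_ord.
have /eqP := subrX1 z n; rewrite zn1 subrr eq_sym mulf_eq0.
by rewrite subr_eq0 (negPf z_neq1) => /eqP.
Qed.

Lemma prim_rootV (K : fieldType) (n : nat) (z : K) :
  n.-primitive_root z -> n.-primitive_root z^-1.
Proof.
move=> prim_z; have n_gt0 := prim_order_gt0 prim_z.
have z_unit : z != 0 by rewrite (prim_root_eq0 prim_z) gtn_eqF.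
have ->: z^-1 = z ^+ n.-1.
  apply: (mulfI z_unit); rewrite divff // -exprS prednK //.
  by rewrite (prim_expr_order prim_z).
by rewrite prim_root_exp_coprime // -{2}(prednK n_gt0) coprimenS.
Qed.

Section Fourier.
Variables (F : finFieldType) (L : fieldType) (iota : {rmorphism F -> L}).
Variables (n : nat) (a : L).
Hypothesis prim_a : n.-primitive_root a.
Implicit Types (c : cycring F n).

Let n_gt0 : (0 < n)%N := prim_order_gt0 prim_a.

Lemma coef_fourier c j : (j < n)%N ->
  (fourier iota a c : {poly L})`_j = code_eval iota c (a ^+ j).
Proof.
move=> lt_jn; rewrite /fourier.
under eq_bigr do rewrite mul_polyC.
rewrite -(poly_def n (fun j => code_eval iota c (a ^+ j))).
by rewrite qbar_small ?size_poly // coef_poly lt_jn.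
Qed.

(** Fourier inversion: after exchanging the two sums, orthogonality of the powers of roots of unity
    leaves only the term k = i. *)
Lemma horner_fourier c (i : 'I_n) :
  (fourier iota a c : {poly L}).[a^-1 ^+ i] = n%:R * iota (c : {poly F})`_i.
Proof.
have n_neq0 : a != 0 by rewrite (prim_root_eq0 prim_a) gtn_eqF.
have an1 : a ^+ n = 1 := prim_expr_order prim_a.
rewrite horner_qbar ?prim_exprXn1 ?prim_rootV // horner_sum.
transitivity (\sum_(j < n) \sum_(k < n)
    iota (c : {poly F})`_k * (a ^+ k / a ^+ i) ^+ j).
  apply: eq_bigr => j _; rewrite hornerM hornerC hornerXn /code_eval.
  rewrite (@horner_coef_wide _ n) ?size_map_poly ?size_cycring //.
  rewrite mulr_suml; apply: eq_bigr => k _.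
  by rewrite coef_map /= -mulrA exprMn !exprVn -!exprM (mulnC k).
rewrite exchange_big /= (bigD1 i) //= -mulr_sumr divff ?expf_neq0 //.
rewrite sum_unity_root ?expr1n // eqxx mulrC big1 ?addr0 // => k ki.
rewrite -mulr_sumr sum_unity_root; last first.
  by rewrite exprMn exprVn !prim_exprXn1 // invr1 mulr1.
have /negPf-> : a ^+ k / a ^+ i != 1.
  rewrite -(inj_eq (mulIf (expf_neq0 i n_neq0))) mulfVK ?expf_neq0 // mul1r.
  by rewrite (inj_eq (prim_expr_inj prim_a)).
by rewrite mulr0.
Qed.

(** The factor n in the inversion formula is nonzero in [L], because [L] has a primitive n-th root
    of unity. *)
Lemma weight_nonroots c : weight c = nonroots n a^-1 (fourier iota a c).
Proof.
apply: eq_card => i; rewrite !inE horner_fourier mulf_eq0 fmorph_eq0.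
by rewrite (negPf (prim_root_natf_neq0 prim_a)).
Qed.

Lemma fourier_neq0 c : c != 0 -> fourier iota a c != 0.
Proof.
apply: contraNneq => fc0; apply/eqP/cycring_inj/polyP=> i; rewrite coef0.
have [lt_in|le_ni] := ltnP i n; last first.
  by rewrite nth_default // (leq_trans (size_cycring n_gt0 c)).
have /esym/eqP := horner_fourier c (Ordinal lt_in).
rewrite fc0 horner0 mulf_eq0 fmorph_eq0 (negPf (prim_root_natf_neq0 prim_a)).
by move/eqP.
Qed.

Lemma app_dist_fourier_le_weight c :
  (app_dist (fourier iota a c) <= weight c)%N.
Proof.
by rewrite weight_nonroots (app_dist_le_nonroots (prim_rootV prim_a)).
Qed.

(** Each power of [a] is a power of its inverse, so by inversion the value is n times a coefficient
    of c and lies in the image of [F]. *)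
Lemma horner_fourier_fixed c (j : nat) :
  let f := (fourier iota a c : {poly L}) in
  f.[a ^+ j] ^+ #|F| = f.[a ^+ j].
Proof.
move=> /=.
have [i ->] := prim_rootP (prim_rootV prim_a) (prim_exprXn1 prim_a j).
by rewrite horner_fourier -(rmorph_nat iota) -rmorphM -rmorphXn expf_card.
Qed.

(** The polynomial X^q - X, for q the order of [F], already splits over [F], so [L] contains no
    further roots of it. *)
Lemma expf_card_eq (x : L) : x ^+ #|F| = x -> exists y, x = iota y.
Proof.
move=> xq; have : root (map_poly iota ('X^#|F| - 'X)) x.
  by rewrite rmorphB /= map_polyXn map_polyX rootE !hornerE xq subrr.
rewrite finField_genPoly rmorph_prod /=.
under eq_bigr do rewrite map_polyXsubC.
rewrite rootE horner_prod => /prodf_eq0[y _].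
by rewrite hornerXsubC subr_eq0 => /eqP ->; exists y.
Qed.

Lemma fourier_surj (f : cycring L n) :
    (forall j : 'I_n,
       (f : {poly L}).[a ^+ j] ^+ #|F| = (f : {poly L}).[a ^+ j]) ->
  exists c, fourier iota a c = f.
Proof.
move=> fixf.
have valF (i : 'I_n) : exists y, (f : {poly L}).[a^-1 ^+ i] = iota y.
  have [j ->] := prim_rootP prim_a (prim_exprXn1 (prim_rootV prim_a) i).
  exact: expf_card_eq.
have [b fb] := choice valF; have n_neq0 := prim_root_natf_neq0 prim_a.
(* The inverse transform: the coefficient at i is the value of f at the i-th power of the inverse of
   [a], pulled back to [F] and divided by n. *)
exists (qbar n (\poly_(i < n) (n%:R^-1 * b (insubd (Ordinal n_gt0) i)))).
apply: (cycring_eq_on_unity (prim_rootV prim_a)) => i.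
rewrite horner_fourier qbar_small ?size_poly // coef_poly ltn_ord valKd.
by rewrite rmorphM fmorphV rmorph_nat mulVKf // fb.
Qed.

End Fourier.

(** * Generators and defining sets of cyclic codes *)

Section CyclicCode.
Variables (F : finFieldType) (L : fieldType) (iota : {rmorphism F -> L}).
Variables (n : nat) (C : {set cycring F n}).
Hypotheses (C_code : cyclic_code C) (C_neq0 : exists2 c, c \in C & c != 0).
Implicit Types (a : L) (c : cycring F n).

Lemma code_generator : (0 < n)%N -> exists c0, [/\ c0 \in C, c0 != 0,
  (c0 : {poly F}) %| 'X^n - 1
  & {in C, forall c, (c0 : {poly F}) %| (c : {poly F})}].
Proof.
move=> n_gt0; have [c1 Cc1 c1_neq0] := C_neq0; have [C0 CD CM] := C_code.
pose P := [pred c : cycring F n | (c \in C) && (c != 0)].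
have Pc1 : P c1 by rewrite /= Cc1.
(* A nonzero codeword of minimal degree divides everything whose image in
   F(n) lies in C, since the remainder is again a codeword. *)
have [c0 /andP[Cc0 c0_neq0] min_c0] :=
  arg_minnP (fun c => size (c : {poly F})) Pc1.
have c0p_neq0 : (c0 : {poly F}) != 0 by rewrite cycring_eq0.
have dvd_c0 (p : {poly F}) : qbar n p \in C -> (c0 : {poly F}) %| p.
  move=> Cp; set r := p %% (c0 : {poly F}).
  have lt_r : (size r < size (c0 : {poly F}))%N by rewrite ltn_modp.
  have qr : qbar n r = r :> {poly F}.
    by rewrite qbar_small // ltnW // (leq_trans lt_r) // size_cycring.
  have Cr : qbar n r \in C.
    have rE : r = p + - (p %/ (c0 : {poly F})) * (c0 : {poly F}).
      by rewrite {1}(divp_eq p (c0 : {poly F})) -/r mulNr addrAC subrr add0r.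
    rewrite rE qbarD; apply: CD => //.
    by rewrite qbarM qbarK //; apply: CM.
  apply/contraT=> ndvd; have Pr : P (qbar n r).
    by apply/andP; split=> //; rewrite -cycring_eq0 qr.
  by have := min_c0 _ Pr; rewrite qr leqNgt lt_r.
exists c0; split=> // [|c Cc]; apply: dvd_c0; last by rewrite qbarK.
suff ->: qbar n ('X^n - 1 : {poly F}) = 0 by [].
by apply: cycring_inj; rewrite qbarE // modpp.
Qed.

Lemma horner_map_polyM (p1 p2 : {poly F}) a :
  (map_poly iota (p1 * p2)).[a]
  = (map_poly iota p1).[a] * (map_poly iota p2).[a].
Proof. by rewrite rmorphM hornerM. Qed.

(** The generator divides every codeword, so its zeros among the roots of unity are zeros of the
    whole code. *)
Lemma code_element_exact_zeros a : n.-primitive_root a ->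
  exists c0, [/\ c0 \in C, c0 != 0
    & forall i : 'I_n,
        (i \in defining_set iota C a) = (code_eval iota c0 (a ^+ i) == 0)].
Proof.
move=> prim_a; have n_gt0 := prim_order_gt0 prim_a.
have [c0 [Cc0 c0_neq0 _ dvd_c0]] := code_generator n_gt0.
exists c0; split=> // i; rewrite inE; apply/forall_inP/idP=> [|c0i c Cc].
  exact.
have /dvdpP[r cE] := dvd_c0 c Cc.
by rewrite /code_eval cE horner_map_polyM [X in _ * X](eqP c0i) mulr0.
Qed.

(** The defining set determines the code. This later converts the support condition on a Fourier
    transform into membership in [C]. *)
Lemma mem_code a c : n.-primitive_root a ->
    (forall i : 'I_n,
       i \in defining_set iota C a -> code_eval iota c (a ^+ i) = 0) ->
  c \in C.
Proof.
move=> prim_a c0D; have n_gt0 := prim_order_gt0 prim_a.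
have [c0 [Cc0 c0_neq0 /dvdpP[r Xn1E] dvd_c0]] := code_generator n_gt0.
have c0p_neq0 : (c0 : {poly F}) != 0 by rewrite cycring_eq0.
have Xn1_neq0 : 'X^n - 1 != 0 :> {poly F} by rewrite -size_poly_gt0 size_XnsubC.
have r_neq0 : r != 0.
  by apply: contraNneq Xn1_neq0; rewrite Xn1E => ->; rewrite mul0r.
(* Every root of unity is a root of r or of c, so x^n - 1 = r c0 divides r c. *)
have : r * (c0 : {poly F}) %| r * (c : {poly F}).
  rewrite -Xn1E -(dvdp_map iota) rmorphB /= map_polyXn rmorph1.
  apply: (dvdp_Xnsub1_on_unity prim_a) => i; rewrite horner_map_polyM.
  have := congr1 (fun p => (map_poly iota p).[a ^+ i]) Xn1E.
  rewrite rmorphB /= map_polyXn rmorph1 !hornerE (prim_exprXn1 prim_a) subrr.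
  rewrite horner_map_polyM.
  move/esym/eqP; rewrite mulf_eq0 => /orP[/eqP->|c0i]; first by rewrite mul0r.
  rewrite [X in _ * X]c0D ?mulr0 // inE; apply/forall_inP=> u Cu.
  have /dvdpP[s uE] := dvd_c0 u Cu.
  by rewrite /code_eval uE horner_map_polyM [X in _ * X](eqP c0i) mulr0.
rewrite dvdp_mul2l // => /dvdpP[s cE].
have [_ _ CM] := C_code.
by rewrite -(qbarK n_gt0 c) cE qbarM qbarK // CM.
Qed.

(** * BCH bounds, apparent distance and minimum distance *)

Lemma defining_setP a c (i : 'I_n) :
  c \in C -> i \in defining_set iota C a -> code_eval iota c (a ^+ i) = 0.
Proof. by move=> Cc; rewrite inE => /forall_inP/(_ c Cc)/eqP. Qed.

Lemma defining_set_run_le_app_dist a s d c : n.-primitive_root a ->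
    (forall i, (i < d)%N -> exists2 j : 'I_n,
       j = s + i %[mod n] & j \in defining_set iota C a) ->
  c \in C -> c != 0 -> (d < app_dist (fourier iota a c))%N.
Proof.
move=> prim_a runD Cc c_neq0; have n_gt0 := prim_order_gt0 prim_a.
apply: (@app_dist_run _ _ n_gt0 _ s); first exact: fourier_neq0.
move=> i /runD[j]; rewrite modn_small // => <- jD.
by rewrite coef_fourier // defining_setP.
Qed.

(** The zero coefficients of the generator's transform are exactly the defining set, so its longest
    run of zeros is a run in the defining set and its apparent distance is itself a BCH bound. *)
Lemma BCH_bound_app_dist a : n.-primitive_root a ->
  exists2 d, BCH_bound iota C d & (app_dist_at iota C a <= d)%N.
Proof.
move=> prim_a; have n_gt0 := prim_order_gt0 prim_a.
have [c0 [Cc0 c0_neq0 DE]] := code_element_exact_zeros prim_a.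
have f_neq0 := fourier_neq0 iota prim_a c0_neq0.
exists (app_dist (fourier iota a c0)); last by rewrite bigminn_le // Cc0.
split; first exact: app_dist_gt0.
exists a => //; have [s run0] := app_dist_run_exists n_gt0 f_neq0.
exists s => i /run0; rewrite coef_fourier ?ltn_mod // => c0i.
exists (Ordinal (ltn_pmod (s + i) n_gt0)); first by rewrite /= modn_mod.
by rewrite DE /= c0i.
Qed.

Lemma BCH_bound_le_app_dist_at d : BCH_bound iota C d ->
  exists2 a : L, n.-primitive_root a & (d <= app_dist_at iota C a)%N.
Proof.
case=> d_gt0 [a prim_a [s runD]]; exists a => //.
have run_le c : c \in C -> c != 0 -> (d <= app_dist (fourier iota a c))%N.
  move=> Cc c_neq0; rewrite -(prednK d_gt0).
  exact: defining_set_run_le_app_dist runD Cc c_neq0.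
apply/bigminn_geP; split=> [|c /andP[]]; last exact: run_le.
(* The default value n of the minimum must be bounded below by d as well; any nonzero codeword gives
   d <= n. *)
have [c Cc c_neq0] := C_neq0.
exact: leq_trans (run_le c Cc c_neq0) (app_dist_le prim_a _).
Qed.

Lemma finite_Uroots a : n.-primitive_root a -> finite_set (Uroots L n).
Proof.
move=> prim_a.
apply: (@sub_finite_set _ _ [set` [seq a ^+ (i : 'I_n) | i <- enum 'I_n]]).
  move=> b /= prim_b.
  have [i ->] := prim_rootP prim_a (prim_expr_order prim_b).
  by apply: map_f; rewrite mem_enum.
exact: finite_seq.
Qed.

Lemma app_dist_at_le a : n.-primitive_root a -> (app_dist_at iota C a <= n)%N.
Proof.
move=> prim_a; have [c Cc c_neq0] := C_neq0.
apply: leq_trans (app_dist_le prim_a (fourier iota a c)).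
by apply: bigminn_le; rewrite Cc.
Qed.

(** Every BCH bound is at most some d*_a(C), hence at most n; thus [max_BCH_bound] is a true
    maximum. *)
Lemma finite_BCH_bound : finite_set [set d | BCH_bound iota C d].
Proof.
apply: (@sub_finite_set _ _ `I_n.+1); last exact: finite_II.
move=> d /= /BCH_bound_le_app_dist_at[a prim_a le_d].
by rewrite ltnS (leq_trans le_d) // app_dist_at_le.
Qed.

Lemma code_app_dist_max a : n.-primitive_root a ->
  (app_dist_at iota C a <= code_app_dist iota C)%N.
Proof.
move=> prim_a; exact: leq_fsbigmax (finite_Uroots prim_a) _.
Qed.

Lemma Rset_inhabited a : n.-primitive_root a -> exists b, Rset iota C b.
Proof.
move=> prim_a; have [b prim_b bE] :=
  fsbigmax_attained (app_dist_at iota C) (finite_Uroots prim_a) prim_a.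
by exists b; split.
Qed.

Lemma code_app_dist_eq_BCH a : n.-primitive_root a ->
  code_app_dist iota C = max_BCH_bound iota C.
Proof.
move=> prim_a; apply/eqP; rewrite eqn_leq; apply/andP; split.
  have [b [prim_b <-]] := Rset_inhabited prim_a.
  have [d Bd le_d] := BCH_bound_app_dist prim_b.
  apply: leq_trans le_d _.
  exact: (@leq_fsbigmax _ _ (fun d => d) d finite_BCH_bound Bd).
have [d0 Bd0 _] := BCH_bound_app_dist prim_a.
have [d Bd] := fsbigmax_attained (fun d => d) finite_BCH_bound Bd0.
rewrite /max_BCH_bound => ->.
have [b prim_b le_d] := BCH_bound_le_app_dist_at Bd.
exact: leq_trans le_d (code_app_dist_max prim_b).
Qed.

Lemma min_dist_attained : (0 < n)%N ->
  exists c, [/\ c \in C, c != 0 & min_dist C = weight c].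
Proof.
move=> n_gt0; have [c1 Cc1 c1_neq0] := C_neq0.
pose P c := (c \in C) && (c != 0).
have Pc1 : P c1 by rewrite /P Cc1.
have le_wn c : P c -> (weight c <= n)%N.
  by rewrite -[leqRHS]card_ord max_card.
have [c /andP[Cc c_neq0] cE] := bigminn_attained Pc1 le_wn.
by exists c.
Qed.

Lemma app_dist_at_le_min_dist a : n.-primitive_root a ->
  (app_dist_at iota C a <= min_dist C)%N.
Proof.
move=> prim_a; have n_gt0 := prim_order_gt0 prim_a.
have [c [Cc c_neq0 ->]] := min_dist_attained n_gt0.
apply: leq_trans (app_dist_fourier_le_weight iota prim_a c).
by apply: bigminn_le; rewrite Cc.
Qed.

End CyclicCode.

Theorem corollary16 (F : finFieldType) (q n : nat) (L : fieldType)
    (iota : {rmorphism F -> L})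
    (cardF : #|F| = q) (n_gt0 : (0 < n)%N) (co_nq : coprime n q)
    (U_in_L : exists z : L, n.-primitive_root z)
    (C : {set cycring F n}) (C_code : cyclic_code C)
    (C_neq0 : exists2 c, c \in C & c != 0) :
  min_dist C = max_BCH_bound iota C <->
  exists (k : 'I_n) (g : {poly L}) (alpha : L),
    [/\ g %| 'X^n - 1,
        Rset iota C alpha
      & let f := qbar n ('X^k * g) in
        [/\ app_dist (qbar n g) = code_app_dist iota C,
            supp f \subset ~: defining_set iota C alpha
          & forall j : 'I_n,
              ((f : {poly L}).[alpha ^+ j]) ^+ q = (f : {poly L}).[alpha ^+ j]]].
Proof.
have [z prim_z] := U_in_L.
rewrite -(code_app_dist_eq_BCH iota C_code C_neq0 prim_z); split=> [dE|].
  have [a [prim_a aE]] := Rset_inhabited iota C prim_z.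
  have prim_b := prim_rootV prim_a.
  have [c [Cc c_neq0 cE]] := min_dist_attained C_neq0 n_gt0.
  pose phi := fourier iota a c.
  have phi_neq0 : phi != 0 by apply: fourier_neq0.
  (* A squeeze: d*_a(C) <= d*(phi) <= weight c = d(C) = d*(C) = d*_a(C), the last step because [a]
     lies in R(C). *)
  have phiE : app_dist phi = weight c.
    apply/eqP; rewrite eqn_leq app_dist_fourier_le_weight //=.
    by rewrite -cE dE -aE bigminn_le // Cc.
  have [h lt_hn] := app_dist_attained n_gt0 phi_neq0.
  (* The divisor is the shift of phi of least degree. *)
  set g := qbar _ _ => szg.
  have g_neq0 : g != 0 by rewrite qbar_shift_eq0.
  have gE : nonroots n a^-1 g = weight c.
    by rewrite nonroots_qbar // nonroots_shift // (weight_nonroots iota prim_a).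
  (* The exponent that undoes the shift by h; the reduction modulo n covers h = 0. *)
  pose k := Ordinal (ltn_pmod (n - h) n_gt0).
  have kE : k = ((n - h) %% n)%N :> nat by [].
  have fE : qbar n ('X^k * (g : {poly L})) = phi.
    apply: (cycring_eq_on_unity prim_a) => i; have wn1 := prim_exprXn1 prim_a i.
    rewrite horner_qbar // hornerM horner_qbar // hornerM !hornerXn mulrA.
    by rewrite kE expr_mod // -exprD subnK ?wn1 ?mul1r // ltnW.
  exists k, g, a; split=> //.
    (* Since d*(phi) is the weight of c, which is the number of nonroots of g, the degree bound for
       g is an equality. *)
    apply: (dvd_size_nonroots prim_b).
      by move: g_neq0; rewrite -cycring_eq0.
    by rewrite gE -phiE.
  rewrite fE qbarK //; split.
  (* From above, d*(g) is at most the number of nonroots of g; from below, the trivial shift h = 0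
     gives n - deg g = d*(phi). *)
  - rewrite -dE cE; apply/eqP; rewrite eqn_leq.
    rewrite -{1}gE app_dist_le_nonroots //= -phiE.
    have := app_dist_bound n_gt0 g_neq0 n_gt0.
    by rewrite expr0 mul1r qbarK // -szg leq_add2l.
  - apply/fintype.subsetP=> i; rewrite [i \in supp _]inE inE.
    apply: contraNN => iD.
    by rewrite coef_fourier // (defining_setP Cc iD).
  - by move=> j; rewrite -cardF horner_fourier_fixed.
case=> [k [g [a [dvd_g [prim_a aE]]]]]; set f := qbar n ('X^k * g).
case=> dgE supp_f f_fix.
(* Condition (3) makes f the transform of a word c over [F]; condition (2) then puts c in [C]. *)
rewrite -cardF in f_fix; have [c cE] := fourier_surj iota prim_a f_fix.
have prim_b := prim_rootV prim_a.
have Cc : c \in C.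
  apply: (mem_code (iota := iota) C_code C_neq0 prim_a) => i iD.
  rewrite -(coef_fourier iota prim_a) // cE; apply/eqP/contraT => fi.
  have : i \in supp f by rewrite inE.
  by move/(fintype.subsetP supp_f); rewrite inE iD.
have le_min := app_dist_at_le_min_dist iota C_neq0 prim_a.
have wE : weight c = nonroots n a^-1 g.
  by rewrite (weight_nonroots iota prim_a) cE nonroots_qbar // nonroots_shift.
have d_gt0 : (0 < code_app_dist iota C)%N.
  rewrite -aE; apply/bigminn_geP; split=> // u /andP[_ u_neq0].
  exact: app_dist_gt0 n_gt0 _ (fourier_neq0 iota prim_a u_neq0).
have w_gt0 : (0 < weight c)%N.
  rewrite (leq_trans d_gt0) // -dgE wE -(nonroots_qbar prim_b).
  exact: app_dist_le_nonroots.
have szg := size_nonroots_dvd prim_b dvd_g; rewrite -wE in szg.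
(* A nonzero weight excludes deg g = n, so g is its own remainder modulo x^n - 1. *)
have le_gn : (size g <= n)%N by move: szg w_gt0; move: (weight c) => *; lia.
have gbar_neq0 : qbar n g != 0.
  by apply: contraTneq d_gt0 => g0; rewrite -dgE /app_dist g0 eqxx.
(* As g divides x^n - 1, the weight of c is n - deg g, which is at most d*(g) = d*(C). With d*(C) <=
   d(C) <= weight c this closes the chain. *)
have le_w : (weight c <= code_app_dist iota C)%N.
  rewrite -dgE; have := app_dist_bound n_gt0 gbar_neq0 n_gt0.
  by rewrite expr0 mul1r qbarK // qbar_small // -szg leq_add2l.
apply/eqP; rewrite eqn_leq -{2}aE le_min andbT (leq_trans _ le_w) //.
apply: bigminn_le; rewrite Cc; apply: contraTneq w_gt0 => ->.
by rewrite -leqNgt leqn0 cards_eq0; apply/eqP/setP=> i; rewrite !inE coef0 eqxx.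
Qed.
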